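(* Let $M$ be an $n$-dimensional complex manifold endowed with a holomorphic volume form $\omega$, let $Z$ be a holomorphic vector field on $M$ and let $\alpha\in\mathcal{O}(M)$ be a holomorphic function. Put $Z_{\mathbb{R}}=2\,\mathrm{Re}\,Z=Z+\overline{Z}$ and $W_{\mathbb{R}}=2\,\mathrm{Im}\,Z=-i(Z-\overline{Z})$. Then $\alpha$ is a holomorphic last multiplier for $Z$ (with respect to $\omega$) if and only if $|\alpha|^2\in C^\infty(M;\mathbb{R})$ is a real last multiplier (with respect to $\omega_{\mathbb{R}}=\omega\wedge\overline{\omega}$) for both real vector fields $Z_{\mathbb{R}}$ and $W_{\mathbb{R}}$.
   Context: A holomorphic volume form on an $n$-dimensional complex manifold $M$ is a nowhere vanishing holomorphic $n$-form $\omega$. $\mathcal{O}(M)$ denotes the holomorphic functions on $M$. Holomorphic vector fields are holomorphic sections of $T^{1,0}M$. Write $d=\partial+\overline{\partial}$, and let $\imath_Z$ be the interior product. A function $\alpha\in\mathcal{O}(M)$ is a holomorphic last multiplier for a holomorphic vector field $Z$ (with respect to $\omega$) if $\partial(\alpha\,\imath_Z\omega)=0$. On the underlying real $2n$-dimensional manifold, use the volume form $\omega_{\mathbb{R}}=\omega\wedge\overline{\omega}$. A function $m\in C^\infty(M;\mathbb{R})$ is a real last multiplier for a real vector field $X$ on $M$ if $d(m\,\imath_X\omega_{\mathbb{R}})=0$. *)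

(* Defs.v *)
From HB Require Import structures.
From mathcomp Require Import all_boot all_order all_algebra all_fingroup.
From mathcomp Require Import all_classical all_reals all_analysis.
From mathcomp Require Import complex.

Set Implicit Arguments.
Unset Strict Implicit.
Unset Printing Implicit Defensive.

Import Order.TTheory GRing.Theory Num.Theory numFieldNormedType.Exports.

#[global] Open Scope classical_set_scope.
#[global] Open Scope ring_scope.
#[global] Open Scope complex_scope.

(* R[i] as the carrier of its numFieldType structure, which is what makes its
   norm topology visible to unification. *)
Notation Cplx R :=
  (Num.NumField.sort (complex_complex__canonical__Num_NumField R)).
Notation Cspace R n := 'rV[Cplx R]_n.

(* Complexified tangent space of C^n: the pair (a, b) stands for
   sum_k a_k d/dz_k + b_k d/dzbar_k.  Real tangent vectors are the (a, a^* ). *)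
Notation Ctangent R n := (Cspace R n * Cspace R n)%type.

Definition rderivable (R : realType) (n : nat) (f : Cspace R n -> Cplx R)
    (x v : Cspace R n) : Prop :=
  derivable (fun t : R => complex.Re (f (x + t%:C *: v)) : R) 0 1 /\
  derivable (fun t : R => complex.Im (f (x + t%:C *: v)) : R) 0 1.

Definition rderive (R : realType) (n : nat) (v : Cspace R n)
    (f : Cspace R n -> Cplx R) (x : Cspace R n) : Cplx R :=
  (derive1 (fun t : R => complex.Re (f (x + t%:C *: v)) : R) 0) +i*
  (derive1 (fun t : R => complex.Im (f (x + t%:C *: v)) : R) 0).

Fixpoint Cr (R : realType) (n : nat) (r : nat) (U : set (Cspace R n))
    (f : Cspace R n -> Cplx R) : Prop :=
  (forall x, U x -> {for x, continuous f}) /\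
  (if r is r'.+1 then
     forall v, (forall x, U x -> rderivable f x v) /\ Cr r' U (rderive v f)
   else True).

Definition smooth_on (R : realType) (n : nat) (U : set (Cspace R n))
    (f : Cspace R n -> Cplx R) : Prop :=
  forall r, Cr r U f.

(* The Wirtinger operators d/dz_k = (d/dx_k - i d/dy_k) / 2 and
   d/dzbar_k = (d/dx_k + i d/dy_k) / 2; d/dy_k is the derivative along i e_k. *)
Definition dz (R : realType) (n : nat) (k : 'I_n) (f : Cspace R n -> Cplx R)
    (x : Cspace R n) : Cplx R :=
  2%:R^-1 * (rderive (delta_mx 0 k) f x
             - 'i%C * rderive ('i%C *: delta_mx 0 k) f x).

Definition dzbar (R : realType) (n : nat) (k : 'I_n) (f : Cspace R n -> Cplx R)
    (x : Cspace R n) : Cplx R :=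
  2%:R^-1 * (rderive (delta_mx 0 k) f x
             + 'i%C * rderive ('i%C *: delta_mx 0 k) f x).

Definition cderive (R : realType) (n : nat) (v : Ctangent R n)
    (f : Cspace R n -> Cplx R) (x : Cspace R n) : Cplx R :=
  \sum_(k < n) (v.1 0 k * dz k f x + v.2 0 k * dzbar k f x).

(* C^oo and annihilated by d-bar: the Cauchy-Riemann definition. *)
Definition holomorphic_on (R : realType) (n : nat) (U : set (Cspace R n))
    (f : Cspace R n -> Cplx R) : Prop :=
  smooth_on U f /\ (forall x, U x -> forall k : 'I_n, dzbar k f x = 0).

Definition conj_tangent (R : realType) (n : nat) (v : Ctangent R n) :
    Ctangent R n :=
  (map_mx conjc v.2, map_mx conjc v.1).

(* [chartV i] is only meaningful on the open set [chart i @` chart_dom i]. *)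
Record complexManifold (R : realType) (n : nat) := ComplexManifold {
  manifold_space :> topologicalType;
  chart_index : Type;
  chart_dom : chart_index -> set manifold_space;
  chart : chart_index -> manifold_space -> Cspace R n;
  chartV : chart_index -> Cspace R n -> manifold_space;
  manifold_hausdorff : hausdorff_space manifold_space;
  manifold_countable : @second_countable manifold_space;
  dom_cover : forall p, exists i, chart_dom i p;
  dom_open : forall i, open (chart_dom i);
  chart_open : forall i, open (chart i @` chart_dom i);
  chartK : forall i p, chart_dom i p -> chartV i (chart i p) = p;
  chart_continuous : forall i p, chart_dom i p -> {for p, continuous (chart i)};
  chartV_continuous :
    forall i x, (chart i @` chart_dom i) x -> {for x, continuous (chartV i)};
  transition_holomorphic : forall i j (l : 'I_n),
    holomorphic_on (chart i @` (chart_dom i `&` chart_dom j))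
      (fun x => chart j (chartV i x) 0 l)
}.

Definition chart_image (R : realType) (n : nat) (M : complexManifold R n)
    (i : chart_index M) : set (Cspace R n) :=
  chart i @` chart_dom i.

Definition transition (R : realType) (n : nat) (M : complexManifold R n)
    (i j : chart_index M) (x : Cspace R n) : Cspace R n :=
  chart j (chartV i x).

(* The complexified differential at p of the transition map from chart i to
   chart j: v is sent to the vector whose dz_l and dzbar_l components are the
   derivatives along v of the l-th coordinate function and of its conjugate. *)
Definition change_chart (R : realType) (n : nat) (M : complexManifold R n)
    (i j : chart_index M) (p : M) (v : Ctangent R n) : Ctangent R n :=
  (\row_l cderive v (fun x => transition i j x 0 l) (chart i p),
   \row_l cderive v (fun x => (transition i j x 0 l)^*) (chart i p)).

Definition smooth_function (R : realType) (n : nat) (M : complexManifold R n)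
    (f : M -> Cplx R) : Prop :=
  forall i, smooth_on (chart_image i) (fun x => f (chartV i x)).

Definition holomorphic_function (R : realType) (n : nat)
    (M : complexManifold R n) (f : M -> Cplx R) : Prop :=
  forall i, holomorphic_on (chart_image i) (fun x => f (chartV i x)).

(* [X p i] lists the components of X at p in chart i; it is only meaningful
   when p lies in [chart_dom i]. *)
Definition cvfield (R : realType) (n : nat) (M : complexManifold R n) : Type :=
  M -> chart_index M -> Ctangent R n.

Definition compatible_field (R : realType) (n : nat) (M : complexManifold R n)
    (X : cvfield M) : Prop :=
  forall p i j, chart_dom i p -> chart_dom j p ->
    X p j = change_chart i j p (X p i).

Definition holomorphic_field (R : realType) (n : nat) (M : complexManifold R n)
    (Z : cvfield M) : Prop :=
  [/\ compatible_field Z,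
      forall p i, chart_dom i p -> (Z p i).2 = 0 &
      forall i (l : 'I_n),
        holomorphic_on (chart_image i) (fun x => (Z (chartV i x) i).1 0 l)].

Definition real_field (R : realType) (n : nat) (M : complexManifold R n)
    (X : cvfield M) : Prop :=
  [/\ compatible_field X,
      forall p i, chart_dom i p -> conj_tangent (X p i) = X p i &
      forall i (l : 'I_n),
        smooth_on (chart_image i) (fun x => (X (chartV i x) i).1 0 l) /\
        smooth_on (chart_image i) (fun x => (X (chartV i x) i).2 0 l)].

Definition conj_field (R : realType) (n : nat) (M : complexManifold R n)
    (X : cvfield M) : cvfield M :=
  fun p i => conj_tangent (X p i).

Definition twice_Re (R : realType) (n : nat) (M : complexManifold R n)
    (Z : cvfield M) : cvfield M :=
  fun p i => Z p i + conj_field Z p i.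

Definition twice_Im (R : realType) (n : nat) (M : complexManifold R n)
    (Z : cvfield M) : cvfield M :=
  fun p i => (- 'i%C) *: (Z p i - conj_field Z p i).

(* [eta p i v] is the value of the k-form eta at p on the k complexified tangent
   vectors with components v in chart i; only meaningful when p lies in
   [chart_dom i]. *)
Definition cform (R : realType) (n : nat) (M : complexManifold R n) (k : nat) :
    Type :=
  M -> chart_index M -> ('I_k -> Ctangent R n) -> Cplx R.

Definition upd_arg (k : nat) (T : Type) (v : 'I_k -> T) (s : 'I_k) (a : T) :
    'I_k -> T :=
  fun t => if t == s then a else v t.

Definition alternating_multilinear (R : realType) (n k : nat)
    (h : ('I_k -> Ctangent R n) -> Cplx R) : Prop :=
  (forall v s c a b,
     h (upd_arg v s (c *: a + b)) =
     c * h (upd_arg v s a) + h (upd_arg v s b)) /\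
  (forall v s t, s != t -> v s = v t -> h v = 0).

Definition compatible_form (R : realType) (n : nat) (M : complexManifold R n)
    (k : nat) (eta : cform M k) : Prop :=
  forall p i j v, chart_dom i p -> chart_dom j p ->
    eta p i v = eta p j (fun s => change_chart i j p (v s)).

(* Holomorphic sections of the bundle of (k, 0)-forms. *)
Definition holomorphic_form (R : realType) (n : nat) (M : complexManifold R n)
    (k : nat) (eta : cform M k) : Prop :=
  [/\ forall p i, chart_dom i p -> alternating_multilinear (eta p i),
      compatible_form eta,
      forall p i v s, chart_dom i p -> (v s).1 = 0 -> eta p i v = 0 &
      forall i v,
        holomorphic_on (chart_image i) (fun x => eta (chartV i x) i v)].

Definition holomorphic_volume_form (R : realType) (n : nat)
    (M : complexManifold R n) (omega : cform M n) : Prop :=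
  holomorphic_form omega /\
  (forall p i, chart_dom i p -> exists v, omega p i v != 0).

Definition mul_form (R : realType) (n : nat) (M : complexManifold R n)
    (k : nat) (f : M -> Cplx R) (eta : cform M k) : cform M k :=
  fun p i v => f p * eta p i v.

Definition conj_form (R : realType) (n : nat) (M : complexManifold R n)
    (k : nat) (eta : cform M k) : cform M k :=
  fun p i v => (eta p i (fun s => conj_tangent (v s)))^*.

Definition interior (R : realType) (n : nat) (M : complexManifold R n)
    (k : nat) (X : cvfield M) (eta : cform M k.+1) : cform M k :=
  fun p i v => eta p i (fun s => oapp v (X p i) (unlift ord0 s)).

(* Normalised so that (a /\ b)(u, v) = a u * b v - a v * b u for 1-forms. *)
Definition wedge (R : realType) (n : nat) (M : complexManifold R n)
    (k l : nat) (eta : cform M k) (theta : cform M l) : cform M (k + l) :=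
  fun p i v =>
    (k`! * l`!)%N%:R^-1 *
    \sum_(sigma : {perm 'I_(k + l)})
      (-1) ^+ sigma * eta p i (fun s => v (sigma (lshift l s)))
                    * theta p i (fun t => v (sigma (rshift k t))).

(* (d eta)(v_0, .., v_k) = sum_s (-1)^s v_s (eta (v_0, .. omit v_s .., v_k)) for
   vectors with constant components in the chart; the operators del and delbar
   keep the d/dz and d/dzbar part of each derivative. *)
Definition extd (R : realType) (n : nat) (M : complexManifold R n)
    (k : nat) (eta : cform M k) : cform M k.+1 :=
  fun p i v => \sum_(s < k.+1) (-1) ^+ s *
    cderive (v s) (fun x => eta (chartV i x) i (fun t => v (lift s t)))
      (chart i p).

Definition del (R : realType) (n : nat) (M : complexManifold R n)
    (k : nat) (eta : cform M k) : cform M k.+1 :=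
  fun p i v => \sum_(s < k.+1) (-1) ^+ s *
    cderive ((v s).1, 0) (fun x => eta (chartV i x) i (fun t => v (lift s t)))
      (chart i p).

Definition delbar (R : realType) (n : nat) (M : complexManifold R n)
    (k : nat) (eta : cform M k) : cform M k.+1 :=
  fun p i v => \sum_(s < k.+1) (-1) ^+ s *
    cderive (0, (v s).2) (fun x => eta (chartV i x) i (fun t => v (lift s t)))
      (chart i p).

Lemma extdE (R : realType) (n : nat) (M : complexManifold R n) (k : nat)
    (eta : cform M k) p i v :
  extd eta p i v = del eta p i v + delbar eta p i v.
Proof.
rewrite /extd /del /delbar -big_split; apply: eq_bigr => s _ /=.
rewrite -mulrDr /cderive -big_split; congr (_ * _); apply: eq_bigr => l _ /=.
by rewrite !mxE !mul0r addr0 add0r.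
Qed.

Definition zero_form (R : realType) (n : nat) (M : complexManifold R n)
    (k : nat) (eta : cform M k) : Prop :=
  forall p i v, chart_dom i p -> eta p i v = 0.

Definition holomorphic_last_multiplier (R : realType) (n : nat)
    (M : complexManifold R n.+1) (omega : cform M n.+1) (Z : cvfield M)
    (alpha : M -> Cplx R) : Prop :=
  [/\ holomorphic_function alpha, holomorphic_field Z &
      zero_form (del (mul_form alpha (interior Z omega)))].

(* The degree (n + n.+1).+1 is convertible to n.+1 + n.+1; it exposes the
   successor needed to take interior products. *)
Definition real_volume_form (R : realType) (n : nat)
    (M : complexManifold R n.+1) (omega : cform M n.+1) :
    cform M (n + n.+1).+1 :=
  wedge omega (conj_form omega).

Definition real_last_multiplier (R : realType) (n k : nat)
    (M : complexManifold R n) (Omega : cform M k.+1) (X : cvfield M)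
    (m : M -> R) : Prop :=
  [/\ smooth_function (fun p => (m p)%:C), real_field X &
      zero_form (extd (mul_form (fun p => (m p)%:C) (interior X Omega)))].

Definition sqr_modulus (R : realType) (T : Type) (alpha : T -> Cplx R) :
    T -> R :=
  fun p => Normc.normc (alpha p) ^+ 2.

(* Main.v *)
Require Import Defs.
From mathcomp Require Import all_boot all_order all_algebra all_fingroup.
From mathcomp Require Import all_classical all_reals all_analysis.
From mathcomp Require Import complex ring.

Set Implicit Arguments.
Unset Strict Implicit.
Unset Printing Implicit Defensive.
Import Order.TTheory GRing.Theory Num.Theory numFieldNormedType.Exports.
Local Open Scope classical_set_scope.
Local Open Scope ring_scope.
Local Open Scope complex_scope.

(** Both multiplier conditions are conditions on one function in each chart.
    Write omega = f dz_1 ... dz_N there, with f holomorphic, put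
    h = alpha f, and let D = sum_k d(h Z_k)/dz_k be the divergence of h Z.

    A form of top degree is a density times a determinant ([form_det]), and the
    derivative of the contraction of such a form with a vector field is the
    divergence of the field times the same determinant ([divergence_det], an
    instance of Cramer's rule).  Hence del (alpha i_Z omega) = D dz_1 ... dz_N
    ([del_multE]).

    By Laplace expansion ([laplace_block]) omega /\ conj omega is, up to a
    nonzero constant c, |f|^2 times the determinant in the 2N coordinates
    dz, dzbar.  The identity above, applied in these 2N coordinates to the field
    Z + conj Z, gives
      d (|alpha|^2 i_X omega_R) = c (conj h D + h conj D) dz_1 ... dzbar_N
    ([extd_real_multE]), because conj h is antiholomorphic and so passes through
    the d/dz_k.  Thus |alpha|^2 is a multiplier for 2 Re Z iff Re (conj h D) = 0.
    As 2 Im Z = 2 Re (- i Z), and D is linear in Z, it is one for 2 Im Z iff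
    Im (conj h D) = 0.  So the right-hand side of the theorem says conj h D = 0.

    It remains to deduce D = 0 from conj h D = 0 at a point x where h may vanish
    ([divergence_eq0]).  D is continuous; if D x <> 0 then D has no zero near x,
    so h vanishes near x, and then so does D = sum_k d(h Z_k)/dz_k. *)

(** * Alternating multilinear maps and determinants *)

Definition multilinear (F : fieldType) (V : lmodType F) (k : nat)
    (h : ('I_k -> V) -> F) : Prop :=
  forall v s c a b, h (upd_arg v s (c *: a + b)) =
    c * h (upd_arg v s a) + h (upd_arg v s b).

Lemma upd_arg_id (k : nat) (T : Type) (v : 'I_k -> T) s : upd_arg v s (v s) = v.
Proof. by apply: funext => t; rewrite /upd_arg; case: eqP => [->|]. Qed.

Lemma multilinear_sum (F : fieldType) (V : lmodType F) (k m : nat)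
    (h : ('I_k -> V) -> F) (v : 'I_k -> V) (s : 'I_k) (c : 'I_m -> F)
    (b : 'I_m -> V) :
  multilinear h ->
  h (upd_arg v s (\sum_j c j *: b j)) = \sum_j c j * h (upd_arg v s (b j)).
Proof.
move=> hlin.
have h0 : h (upd_arg v s 0) = 0.
  have := hlin v s (-1) 0 0.
  by rewrite scaler0 addr0 mulN1r addNr.
elim: m c b => [|m IH] c b; first by rewrite !big_ord0.
by rewrite !big_ord_recl hlin IH.
Qed.

(** The coefficients of an expansion over S come out of each argument in turn,
    so one argument after the other can be moved into S.  The set S is allowed
    to be larger than a basis: [form_det] takes all antiholomorphic vectors. *)
Lemma multilinear_eq0 (F : fieldType) (V : lmodType F) (k : nat)
    (h : ('I_k -> V) -> F) (S : V -> Prop) :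
  multilinear h ->
  (forall w, exists m (c : 'I_m -> F) (b : 'I_m -> V),
     (forall j, S (b j)) /\ w = \sum_j c j *: b j) ->
  (forall v, (forall s, S (v s)) -> h v = 0) ->
  forall v, h v = 0.
Proof.
move=> hlin gen hS v.
suff H (r : seq 'I_k) w : (forall t, t \notin r -> S (w t)) -> h w = 0.
  by apply: (H (enum 'I_k)) => t; rewrite mem_enum.
elim: r w => [|s r IH] w Sw; first by apply: hS => t; apply: Sw.
have [m [c [b [Sb wE]]]] := gen (w s).
rewrite -(upd_arg_id w s) wE multilinear_sum // big1 // => j _.
rewrite IH ?mulr0 // => t tr; rewrite /upd_arg; case: eqVneq => // ts.
by apply: Sw; rewrite inE (negPf ts).
Qed.

(** Expanding h at (v s + v t) in both positions s and t shows that a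
    transposition changes the sign; transpositions generate the group. *)
Lemma alternating_perm (F : fieldType) (V : lmodType F) (k : nat)
    (h : ('I_k -> V) -> F) :
  multilinear h ->
  (forall v s t, s != t -> v s = v t -> h v = 0) ->
  forall (sigma : 'S_k) v, h (v \o sigma) = (-1) ^+ sigma * h v.
Proof.
move=> hlin halt.
have swap s t v : s != t -> h (v \o tperm s t) = - h v.
  move=> st.
  pose g a b := h (upd_arg (upd_arg v s a) t b).
  have gDr a b c : g a (b + c) = g a b + g a c.
    by rewrite /g -[b in LHS]scale1r hlin mul1r.
  have gDl a b c : g (a + b) c = g a c + g b c.
    have updC x y : upd_arg (upd_arg v s x) t y = upd_arg (upd_arg v t y) s x.
      apply: funext => u; rewrite /upd_arg; case: eqVneq => // ->.
      by rewrite eq_sym (negPf st).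
    by rewrite /g !updC -[a in LHS]scale1r hlin mul1r.
  have gg a : g a a = 0.
    apply: (halt _ s t st); rewrite /upd_arg !eqxx.
    by rewrite (negPf st).
  have := gg (v s + v t).
  rewrite gDl !gDr !gg add0r addr0 => /eqP; rewrite addr_eq0 => /eqP gN.
  have -> : h v = g (v s) (v t).
    rewrite /g; congr h; apply: funext => u; rewrite /upd_arg.
    by case: eqVneq => [->//|_]; case: eqVneq => [->|].
  have -> : h (v \o tperm s t) = g (v t) (v s); last by rewrite gN opprK.
  rewrite /g; congr h; apply: funext => u /=; rewrite /upd_arg.
  by case: tpermP => [->|->|/eqP/negPf-> /eqP/negPf->]; rewrite ?eqxx // (negPf st).
move=> sigma; have [ts -> tsP] := prod_tpermP sigma.
elim: ts tsP => [_|[s t] ts IH /andP[/= st tsP]] v.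
  by rewrite big_nil odd_perm1 mul1r; congr h; apply: funext => u /=; rewrite perm1.
rewrite big_cons odd_mul_tperm st signr_addb /= expr1 mulN1r mulNr -IH //.
rewrite -(swap _ _ _ st); congr h; apply: funext => u /=.
by rewrite permM.
Qed.

(** The difference of the two sides is multilinear, so it suffices to evaluate
    it on tuples of vectors d/dz_j and (0, b).  It vanishes if some vector is
    (0, b), if some d/dz_j is repeated, and, by [alternating_perm], on the
    permutations of the d/dz_j. *)
Lemma form_det (R : realType) (n : nat)
    (h : ('I_n -> Ctangent R n) -> Cplx R) :
  alternating_multilinear h ->
  (forall v s, (v s).1 = 0 -> h v = 0) ->
  forall v, h v = h (fun s => (delta_mx 0 s, 0))
                  * \det (\matrix_s (v s).1).
Proof.
move=> [hlin halt] h10 v; apply/eqP; rewrite -subr_eq0; apply/eqP.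
move: v; set e := fun s => _.
pose S (w : Ctangent R n) := w.1 = 0 \/ exists j, w = e j.
apply: (@multilinear_eq0 _ (Ctangent R n) _ _ S).
- move=> v s c a b; rewrite hlin.
  rewrite (@determinant_multilinear _ _ _ (\matrix_t (upd_arg v s a t).1)
    (\matrix_t (upd_arg v s b t).1) s c 1) /=; first by ring.
  + by apply/rowP => j; rewrite !mxE /upd_arg eqxx /= !mxE mul1r.
  + by apply/matrixP => i j; rewrite !mxE /upd_arg eq_sym (negPf (neq_lift _ _)).
  + by apply/matrixP => i j; rewrite !mxE /upd_arg eq_sym (negPf (neq_lift _ _)).
- move=> w.
  (* The extra index ord0 carries the antiholomorphic part of w. *)
  exists n.+1, (fun j => oapp (w.1 0) 1 (unlift ord0 j)),
    (fun j => oapp e (0, w.2) (unlift ord0 j)); split.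
    move=> j; case: unliftP => [j' _|_] /=; [by right; exists j'|by left].
  rewrite big_ord_recl unlift_none /= scale1r.
  under eq_bigr => j _ do rewrite liftK /=.
  case: w => a b /=; apply/pair_equal_spec; split.
    rewrite add0r (raddf_sum fst) {1}(row_sum_delta a).
    by apply: eq_bigr.
  rewrite (raddf_sum snd) big1 ?addr0 // => j _ /=.
  by rewrite scaler0.
- move=> v Sv; case: (pselect (exists s, (v s).1 = 0)) => [[s vs]|nv].
    rewrite (h10 v s vs) sub0r; apply/eqP; rewrite oppr_eq0 mulf_eq0; apply/orP.
    right; rewrite (expand_det_row _ s) big1 // => j _.
    by rewrite mxE vs mxE mul0r.
  have {Sv nv} /choice [phi vE] s : exists j, v s = e j.
    by case: (Sv s) => // vs; case: nv; exists s.
  case: (pselect (injective phi)) => [phiI|].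
    have -> : v = e \o perm phiI by apply: funext => s; rewrite vE /= permE.
    rewrite alternating_perm // mulrC; apply/eqP; rewrite subr_eq0; apply/eqP.
    congr (_ * _); rewrite -det_perm; congr (\det _).
    by apply/matrixP => i j; rewrite !mxE /= eq_sym.
  move=> /existsNP[s /existsNP[t /not_implyP[st /eqP nst]]].
  rewrite (halt v s t nst) ?vE ?st // sub0r; apply/eqP.
  rewrite oppr_eq0 mulf_eq0; apply/orP; right.
  by rewrite (determinant_alternate nst) // => j; rewrite !mxE !vE st.
Qed.

(** The coordinate form of d (i_Y vol) = div Y vol.  Expanding the determinant
    along its first row Y produces the cofactors of V, and
    sum_s V s k * cofactor V s j = (k == j) * \det V by Cramer's rule, so only
    the diagonal terms D_j (g Y_j) survive.  Here the D_k stand for the partial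
    derivatives at a point, which occur only through their additivity. *)
Lemma divergence_det (F : fieldType) (K : nat) (A : Type)
    (D : 'I_K.+1 -> (A -> F) -> F) (g : A -> F) (Y : A -> 'rV[F]_K.+1)
    (V : 'M[F]_K.+1) :
  (forall k (c : 'I_K.+1 -> F),
     D k (fun x => \sum_j g x * Y x 0 j * c j) =
     \sum_j D k (fun x => g x * Y x 0 j) * c j) ->
  \sum_(s < K.+1) (-1) ^+ s * \sum_k V s k * D k (fun x => g x *
     \det (\matrix_t oapp (fun t' => row (lift s t') V) (Y x) (unlift ord0 t)))
  = (\sum_j D j (fun x => g x * Y x 0 j)) * \det V.
Proof.
move=> Dlin.
have detE s x : g x * \det (\matrix_t oapp (fun t' => row (lift s t') V) (Y x)
    (unlift ord0 t)) = \sum_j g x * Y x 0 j * ((-1) ^+ s * cofactor V s j).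
  rewrite (expand_det_row _ ord0) mulr_sumr; apply: eq_bigr => j _.
  rewrite mxE unlift_none /= -mulrA; congr (_ * (_ * _)).
  rewrite /cofactor /= add0n exprD mulrA mulrA -expr2 sqrr_sign mul1r.
  congr (_ * \det _).
  by apply/matrixP => a b; rewrite !mxE liftK mxE.
under eq_bigr => s _.
  under eq_bigr => k _.
    rewrite (funext (detE s)) Dlin.
    over.
  over.
rewrite mulr_suml.
under eq_bigr => s _.
  rewrite mulr_sumr; under eq_bigr => k _ do rewrite !mulr_sumr.
  over.
rewrite exchange_big /=.
under eq_bigr => k _.
  rewrite exchange_big /=.
  under eq_bigr => j _.
    under eq_bigr => s _.
      rewrite (_ : (-1) ^+ s * _ =
        D k (fun x => g x * Y x 0 j) * (cofactor V s j * V s k)); last first.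
        rewrite (mulrCA _ (V s k)) (mulrCA _ (D _ _)) [(-1) ^+ s * (_ * _)]mulrA.
        by rewrite -expr2 sqrr_sign mul1r mulrCA [V s k * _]mulrC.
      over.
    rewrite -mulr_sumr.
    over.
  over.
(* Cramer's rule, after collecting the factors that depend on s. *)
have adjE j k : \sum_s cofactor V s j * V s k = (\det V) *+ (j == k).
  have := congr1 (fun B : 'M[F]_K.+1 => B j k) (mul_adj_mx V).
  by rewrite !mxE => <-; apply: eq_bigr => s _; rewrite mxE.
apply: eq_bigr => k _; under eq_bigr => j _ do rewrite adjE.
rewrite (bigD1 k) //= eqxx mulr1n big1 ?addr0 // => j jk.
by rewrite (negPf jk) mulr0n mulr0.
Qed.

(** The product of the two minors is the determinant of a block diagonal matrix,
    hence a sum over the permutations tau that preserve the two blocks of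
    indices.  After exchanging the sums, each tau contributes a full \det V, so
    the constant is the number of such tau; it is positive because tau = 1
    occurs. *)
Lemma laplace_block (F : comNzRingType) (m p : nat) :
  exists2 c : nat, c != 0%N & forall V : 'M[F]_(m + p),
  \sum_(sigma : 'S_(m + p)) (-1) ^+ sigma *
     \det (\matrix_(l < m, k < m) V (sigma (lshift p l)) (lshift p k)) *
     \det (\matrix_(l < p, k < p) V (sigma (rshift m l)) (rshift m k))
  = c%:R * \det V.
Proof.
pose side (s : 'I_(m + p)) := if fintype.split s is inl _ then true else false.
pose good (tau : 'S_(m + p)) := [forall s, side (tau s) == side s].
exists #|[pred tau | good tau]|.
  rewrite -lt0n; apply/card_gt0P; exists 1%g; rewrite inE.
  by apply/forallP => s; rewrite perm1.
move=> V.
have blockE sigma : 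
     \det (\matrix_(l < m, k < m) V (sigma (lshift p l)) (lshift p k)) *
     \det (\matrix_(l < p, k < p) V (sigma (rshift m l)) (rshift m k))
   = \sum_(tau : 'S_(m + p) | good tau) (-1) ^+ tau * \prod_s V (sigma s) (tau s).
  rewrite -(det_lblock _ 0) /determinant big_mkcond [RHS]big_mkcond /=.
  apply: eq_bigr => tau _; case: ifPn => [gt|]; last first.
    rewrite negb_forall => /existsP[s sP].
    rewrite (bigD1 s) //= mxE.
    move: sP; rewrite /side.
    case: (splitP s) => j sE; rewrite mxE.
      case: (splitP (tau s)) => // k _ _; by rewrite mxE mul0r mulr0.
    case: (splitP (tau s)) => // k _ _; by rewrite mxE mul0r mulr0.
  congr (_ * _); apply: eq_bigr => s _.
  have /eqP := forallP gt s; rewrite /side.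
  rewrite mxE; case: (splitP s) => i si; rewrite mxE;
    case: (splitP (tau s)) => j tj // _; rewrite !mxE;
    by congr (V (sigma _) _); apply: val_inj; rewrite /= ?si ?tj.
under eq_bigr => sigma _ do rewrite -mulrA blockE mulr_sumr.
rewrite exchange_big /= -sum1_card natr_sum mulr_suml.
apply: eq_bigr => tau _; rewrite mul1r.
rewrite -det_tr [in RHS]/determinant (reindex_inj (mulgI tau)) /=.
apply: eq_bigr => sigma _.
rewrite odd_permM signr_addb [X in X * _ = _]mulrC -mulrA [X in _ * X = _]mulrA.
rewrite -expr2 sqrr_sign mul1r; congr (_ * _).
rewrite [RHS](reindex_inj (@perm_inj _ tau)) /=.
by apply: eq_bigr => s _; rewrite mxE permM.
Qed.

(** * Conjugation on the coordinate field *)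

(** These two are the morphism laws of conjugation, stated at the type [Cplx R]
    at which the coordinate functions take their values. *)
Lemma conjM (R : realType) (a b : Cplx R) : (a * b)^* = a^* * b^* :> Cplx R.
Proof. exact: rmorphM. Qed.

Lemma conj_sum (R : realType) (m : nat) (F : 'I_m -> Cplx R) :
  (\sum_j F j)^* = \sum_j (F j)^* :> Cplx R.
Proof. exact: rmorph_sum. Qed.

Lemma conj_i (R : realType) : ('i%C : Cplx R)^* = - 'i%C.
Proof. by apply/eqP; rewrite eq_complex /= oppr0 !eqxx. Qed.

Lemma conjNi (R : realType) : (- 'i%C : Cplx R)^* = 'i%C.
Proof. by apply/eqP; rewrite eq_complex /= oppr0 opprK !eqxx. Qed.

(** * Directional derivatives and functions of class C^r *)

(** [rderivable] and [rderive] combined into one relation, so that a rule gives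
    derivability and the value of the derivative at the same time. *)
Definition is_rderive (R : realType) (n : nat) (f : Cspace R n -> Cplx R)
    (x v : Cspace R n) (l : Cplx R) : Prop :=
  is_derive (0 : R) 1 (fun t : R => complex.Re (f (x + t%:C *: v)) : R)
    (complex.Re l) /\
  is_derive (0 : R) 1 (fun t : R => complex.Im (f (x + t%:C *: v)) : R)
    (complex.Im l).

Lemma is_rderiveP (R : realType) (n : nat) (f : Cspace R n -> Cplx R)
    (x v : Cspace R n) (l : Cplx R) :
  is_rderive f x v l <-> rderivable f x v /\ rderive v f x = l.
Proof.
have E (g : R -> R) : derive1 g 0 = 'D_1 g 0 by rewrite derive1E.
rewrite /is_rderive /rderive !E; split=> [[[dr er] [di ei]]|[[dr di] <-]].
  by rewrite er ei; split=> //; case: l {er ei}.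
by split; exact: derivableP.
Qed.

Lemma is_rderive_cst (R : realType) (n : nat) (c : Cplx R) (x v : Cspace R n) :
  is_rderive (fun=> c) x v 0.
Proof. by split; apply: is_derive_cst. Qed.

Lemma is_rderiveD (R : realType) (n : nat) (f g : Cspace R n -> Cplx R)
    (x v : Cspace R n) (a b : Cplx R) :
  is_rderive f x v a -> is_rderive g x v b ->
  is_rderive (fun y => f y + g y) x v (a + b).
Proof.
have ReD (z w : Cplx R) : complex.Re (z + w) = complex.Re z + complex.Re w.
  by case: z w => ? ? [].
have ImD (z w : Cplx R) : complex.Im (z + w) = complex.Im z + complex.Im w.
  by case: z w => ? ? [].
move=> [fr fi] [gr gi]; split.
  under eq_fun do rewrite ReD; rewrite ReD; exact: is_deriveD.
by under eq_fun do rewrite ImD; rewrite ImD; exact: is_deriveD.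
Qed.

Lemma is_rderiveM (R : realType) (n : nat) (f g : Cspace R n -> Cplx R)
    (x v : Cspace R n) (a b : Cplx R) :
  is_rderive f x v a -> is_rderive g x v b ->
  is_rderive (fun y => f y * g y) x v (a * g x + f x * b).
Proof.
have ReM (z w : Cplx R) : complex.Re (z * w) =
    complex.Re z * complex.Re w - complex.Im z * complex.Im w.
  by case: z w => ? ? [].
have ImM (z w : Cplx R) : complex.Im (z * w) =
    complex.Re z * complex.Im w + complex.Im z * complex.Re w.
  by case: z w => ? ? [].
move=> [fr fi] [gr gi].
have x0 : x + (0 : R)%:C *: v = x by rewrite scale0r addr0.
split.
  under eq_fun do rewrite ReM.
  apply: (is_derive_eq (is_deriveB (is_deriveM fr gr) (is_deriveM fi gi))).
  rewrite /= !x0 /GRing.scale /=.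
  case: a b (f x) (g x) {fr fi gr gi} => [? ?] [? ?] [? ?] [? ?] /=; ring.
under eq_fun do rewrite ImM.
apply: (is_derive_eq (is_deriveD (is_deriveM fr gi) (is_deriveM fi gr))).
rewrite /= !x0 /GRing.scale /=.
case: a b (f x) (g x) {fr fi gr gi} => [? ?] [? ?] [? ?] [? ?] /=; ring.
Qed.

Lemma is_rderive_conj (R : realType) (n : nat) (f : Cspace R n -> Cplx R)
    (x v : Cspace R n) (a : Cplx R) :
  is_rderive f x v a -> is_rderive (fun y => (f y)^*) x v a^*.
Proof.
have ReJ (z : Cplx R) : complex.Re z^* = complex.Re z by case: z.
have ImJ (z : Cplx R) : complex.Im z^* = - complex.Im z by case: z.
move=> [fr fi]; split; first by under eq_fun do rewrite ReJ; rewrite ReJ.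
by under eq_fun do rewrite ImJ; rewrite ImJ; exact: is_deriveN.
Qed.

(** Real multiples approach a point along the complex topology; this turns
    equality near a point into equality near 0 on each real line through it. *)
Lemma cvg_real_line (R : realType) (n : nat) (x v : Cspace R n) :
  (fun t : R => x + t%:C *: v) @ (0 : R) --> x.
Proof.
have cC : (t%:C : Cplx R) @[t --> (0 : R)] --> (0%:C : Cplx R).
  apply/cvgrPdist_lt => e e0.
  (* The radius e is an element of R[i]; being positive, it is real. *)
  have eR : e = (complex.Re e)%:C.
    by case: e e0 => a b; rewrite ltcE /= => /andP[/eqP-> _].
  have e'0 : 0 < complex.Re e by move: e0; rewrite {1}eR ltcR.
  near=> t.
  rewrite -rmorphB /= normc_def /= expr0n addr0 sqrtr_sqr eR ltcR sub0r normrN.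
  by near: t; exists (complex.Re e) => // u /=; rewrite sub0r normrN.
rewrite -[X in _ --> X]addr0 -(scale0r v); apply: cvgD; first exact: cvg_cst.
exact: cvgZr_tmp.
Unshelve. all: by end_near. Qed.

Lemma near_is_rderive (R : realType) (n : nat) (f g : Cspace R n -> Cplx R)
    (x v : Cspace R n) (a : Cplx R) :
  (\forall y \near x, f y = g y) ->
  is_rderive f x v a -> is_rderive g x v a.
Proof.
move=> fg [fr fi].
have fgt : \forall t \near (0 : R), f (x + t%:C *: v) = g (x + t%:C *: v).
  exact: (@cvg_real_line R n x v _ fg).
split; [apply: (near_eq_is_derive _ fr)|apply: (near_eq_is_derive _ fi)];
  by apply: filterS fgt => t /= ->.
Qed.

Lemma Cr_cont (R : realType) (n r : nat) (U : set (Cspace R n)) f x :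
  Cr r U f -> U x -> {for x, continuous f}.
Proof. by case: r => [|r] [cf _]; apply: cf. Qed.

Lemma near_continuous (T U : topologicalType) (f g : T -> U) x :
  (\forall y \near x, f y = g y) -> {for x, continuous f} ->
  {for x, continuous g}.
Proof.
move=> fg cf; have fgx : f x = g x := nbhs_singleton fg.
have : f @ x --> g x by rewrite -fgx; exact: cf.
by apply: cvg_trans; exact: near_eq_cvg.
Qed.

(** On an open set U the derivatives that occur in [Cr r U] are determined by
    the values on U: a short real segment about a point of U stays in U. *)
Lemma eq_Cr (R : realType) (n r : nat) (U : set (Cspace R n))
    (f g : Cspace R n -> Cplx R) :
  open U -> (forall x, U x -> f x = g x) -> Cr r U f -> Cr r U g.
Proof.
move=> Uo.
have near_fg (f' g' : Cspace R n -> Cplx R) : (forall x, U x -> f' x = g' x) ->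
    forall x, U x -> \forall y \near x, f' y = g' y.
  move=> fg x Ux; apply: filterS (open_nbhs_nbhs (conj Uo Ux)) => y; exact: fg.
elim: r f g => [|r IH] f g fg [cf df].
  by split=> [x Ux|]; [exact: near_continuous (near_fg _ _ fg _ Ux) (cf _ Ux)|].
split=> [x Ux|v].
  exact: near_continuous (near_fg _ _ fg _ Ux) (cf _ Ux).
have {df} [df d1f] := df v.
have dg x : U x -> is_rderive g x v (rderive v f x).
  move=> Ux; apply: near_is_rderive (near_fg _ _ fg x Ux) _.
  by apply/is_rderiveP; split=> //; apply: df.
split=> [x /dg /is_rderiveP[]//|].
by apply: IH d1f => x /dg /is_rderiveP[_ ->].
Qed.

(** The class of f g uses both f and f', so the induction in [CrM] has to
    regard a C^(r+1) function as a C^r function. *)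
Lemma CrW (R : realType) (n r : nat) (U : set (Cspace R n)) f :
  Cr r.+1 U f -> Cr r U f.
Proof.
elim: r f => [|r IH] f [cf df]; first by split=> [x Ux|]; [exact: cf|].
split=> [x Ux|v]; first exact: cf.
by have [dv d1v] := df v; split=> [x Ux|]; [exact: dv|exact: IH].
Qed.

Lemma Cr_cst (R : realType) (n r : nat) (U : set (Cspace R n)) (c : Cplx R) :
  Cr r U (fun=> c).
Proof.
elim: r c => [|r IH] c; first by split=> [x _|//]; exact: cst_continuous.
split=> [x _|v]; first exact: cst_continuous.
have d x : is_rderive (fun=> c) x v 0 by exact: is_rderive_cst.
split=> [x _|]; first by have /is_rderiveP[] := d x.
rewrite (_ : rderive _ _ = fun=> 0) //; apply: funext => x.
by have /is_rderiveP[_ ->] := d x.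
Qed.

Lemma is_rderive_Cr (R : realType) (n r : nat) (U : set (Cspace R n)) f x v :
  Cr r.+1 U f -> U x -> is_rderive f x v (rderive v f x).
Proof. by move=> [_ /(_ v)[df _]] Ux; apply/is_rderiveP; split=> //; apply: df. Qed.

Lemma CrD (R : realType) (n r : nat) (U : set (Cspace R n))
    (f g : Cspace R n -> Cplx R) :
  open U -> Cr r U f -> Cr r U g -> Cr r U (fun x => f x + g x).
Proof.
move=> Uo; elim: r f g => [|r IH] f g Cf Cg.
  by split=> [x Ux|//]; apply: continuousD; [exact: Cr_cont Cf Ux|exact: Cr_cont Cg Ux].
split=> [x Ux|v].
  by apply: continuousD; [exact: Cr_cont Cf Ux|exact: Cr_cont Cg Ux].
have d x (Ux : U x) := is_rderiveD (is_rderive_Cr v Cf Ux) (is_rderive_Cr v Cg Ux).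
split=> [x /d /is_rderiveP[]//|].
apply: (@eq_Cr _ _ _ _ (fun x => rderive v f x + rderive v g x)) => //.
  by move=> x /d /is_rderiveP[_ ->].
by apply: IH; [have [_ /(_ v)[]] := Cf|have [_ /(_ v)[]] := Cg].
Qed.

Lemma CrM (R : realType) (n r : nat) (U : set (Cspace R n))
    (f g : Cspace R n -> Cplx R) :
  open U -> Cr r U f -> Cr r U g -> Cr r U (fun x => f x * g x).
Proof.
move=> Uo; elim: r f g => [|r IH] f g Cf Cg.
  by split=> [x Ux|//]; apply: continuousM; [exact: Cr_cont Cf Ux|exact: Cr_cont Cg Ux].
split=> [x Ux|v].
  by apply: continuousM; [exact: Cr_cont Cf Ux|exact: Cr_cont Cg Ux].
have d x (Ux : U x) := is_rderiveM (is_rderive_Cr v Cf Ux) (is_rderive_Cr v Cg Ux).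
split=> [x /d /is_rderiveP[]//|].
apply: (@eq_Cr _ _ _ _ (fun x => rderive v f x * g x + f x * rderive v g x)) => //.
  by move=> x /d /is_rderiveP[_ ->].
have [_ /(_ v)[_ Cdf]] := Cf; have [_ /(_ v)[_ Cdg]] := Cg.
exact: (CrD Uo (IH _ _ Cdf (CrW Cg)) (IH _ _ (CrW Cf) Cdg)).
Qed.

Lemma Cr_conj (R : realType) (n r : nat) (U : set (Cspace R n))
    (f : Cspace R n -> Cplx R) :
  open U -> Cr r U f -> Cr r U (fun x => (f x)^*).
Proof.
have conj_cont (z : Cplx R) : {for z, continuous (@conjc R : Cplx R -> Cplx R)}.
  suff : (@conjc R : Cplx R -> Cplx R) @ z --> (z^* : Cplx R) by [].
  have Fz := @nbhs_filter (Cplx R) z.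
  apply/(@cvgrPdist_lt _ _ _ _ Fz) => e e0; exists e => // y; rewrite /ball_ /= => zy.
  by rewrite -rmorphB /= normcJ.
have c (f' : Cspace R n -> Cplx R) x : {for x, continuous f'} ->
    {for x, continuous (fun x => (f' x)^* : Cplx R)}.
  by move=> cf; exact: (cvg_comp f' (@conjc R : Cplx R -> Cplx R) cf (conj_cont _)).
move=> Uo; elim: r f => [|r IH] f Cf.
  by split=> [x Ux|//]; apply: c; exact: Cr_cont Cf Ux.
split=> [x Ux|v]; first by apply: c; exact: Cr_cont Cf Ux.
have d x (Ux : U x) := is_rderive_conj (is_rderive_Cr v Cf Ux).
split=> [x /d /is_rderiveP[]//|].
apply: (@eq_Cr _ _ _ _ (fun x => (rderive v f x)^*)) => //.
  by move=> x /d /is_rderiveP[_ ->].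
by apply: IH; have [_ /(_ v)[]] := Cf.
Qed.

(** * The Wirtinger operators *)

(** Derivability at one point in every real direction: what the Leibniz and
    conjugation rules for the Wirtinger operators need of smoothness. *)
Definition rdiff (R : realType) (n : nat) (f : Cspace R n -> Cplx R)
    (x : Cspace R n) : Prop := forall v, rderivable f x v.

Lemma smooth_rdiff (R : realType) (n : nat) (U : set (Cspace R n)) f x :
  smooth_on U f -> U x -> rdiff f x.
Proof. by move=> /(_ 1%N) Cf Ux v; have /is_rderiveP[] := is_rderive_Cr v Cf Ux. Qed.

Lemma rdiff_is (R : realType) (n : nat) (f : Cspace R n -> Cplx R) x v :
  rdiff f x -> is_rderive f x v (rderive v f x).
Proof. by move=> /(_ v) df; apply/is_rderiveP. Qed.

Lemma rdiff_cst (R : realType) (n : nat) (c : Cplx R) (x : Cspace R n) :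
  rdiff (fun=> c) x.
Proof. by move=> v; have /is_rderiveP[] := is_rderive_cst c x v. Qed.

Lemma rdiffM (R : realType) (n : nat) (f g : Cspace R n -> Cplx R) x :
  rdiff f x -> rdiff g x -> rdiff (fun y => f y * g y) x.
Proof.
move=> df dg v.
by have /is_rderiveP[] := is_rderiveM (rdiff_is v df) (rdiff_is v dg).
Qed.

Lemma rdiff_conj (R : realType) (n : nat) (f : Cspace R n -> Cplx R) x :
  rdiff f x -> rdiff (fun y => (f y)^*) x.
Proof.
by move=> df v; have /is_rderiveP[] := is_rderive_conj (rdiff_is v df).
Qed.

Lemma rderiveM (R : realType) (n : nat) (f g : Cspace R n -> Cplx R) x v :
  rdiff f x -> rdiff g x ->
  rderive v (fun y => f y * g y) x = rderive v f x * g x + f x * rderive v g x.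
Proof.
move=> df dg.
by have /is_rderiveP[_] := is_rderiveM (rdiff_is v df) (rdiff_is v dg).
Qed.

Lemma rderive_conj (R : realType) (n : nat) (f : Cspace R n -> Cplx R) x v :
  rdiff f x -> rderive v (fun y => (f y)^*) x = (rderive v f x)^*.
Proof.
by move=> df; have /is_rderiveP[_] := is_rderive_conj (rdiff_is v df).
Qed.

Lemma rderive_lincomb (R : realType) (n m : nat)
    (f : 'I_m -> Cspace R n -> Cplx R) (c : 'I_m -> Cplx R) x v :
  (forall j, rdiff (f j) x) ->
  rderive v (fun y => \sum_j f j y * c j) x = \sum_j rderive v (f j) x * c j.
Proof.
move=> df.
suff /is_rderiveP[] : is_rderive (fun y => \sum_j f j y * c j) x v
  (\sum_j rderive v (f j) x * c j) by [].
elim: m f c df => [|m IH] f c df.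
  under eq_fun do rewrite big_ord0; rewrite big_ord0; exact: is_rderive_cst.
under eq_fun do rewrite big_ord_recl; rewrite big_ord_recl.
apply: is_rderiveD; last by apply: IH => j; exact: df.
have := is_rderiveM (rdiff_is v (df ord0)) (is_rderive_cst (c ord0) x v).
by rewrite mulr0 addr0.
Qed.

(** This lets a form be replaced by its coordinate expression, which is valid
    only inside the chart, before it is differentiated. *)
Lemma near_rderive (R : realType) (n : nat) (f g : Cspace R n -> Cplx R)
    (x v : Cspace R n) :
  (\forall y \near x, f y = g y) -> rderive v f x = rderive v g x.
Proof.
move=> fg.
have fgt : \forall t \near (0 : R), f (x + t%:C *: v) = g (x + t%:C *: v).
  exact: (@cvg_real_line R n x v _ fg).
rewrite /rderive !derive1E; congr (_ +i* _); apply: near_eq_derive;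
  by apply: filterS fgt => t /= ->.
Qed.

Lemma dzM (R : realType) (n : nat) (f g : Cspace R n -> Cplx R) x k :
  rdiff f x -> rdiff g x ->
  dz k (fun y => f y * g y) x = dz k f x * g x + f x * dz k g x.
Proof.
have alg (F : comNzRingType) (h i a b c d u w : F) : h * (a * w + u * b -
    i * (c * w + u * d)) = h * (a - i * c) * w + u * (h * (b - i * d)) by ring.
move=> df dg; rewrite /dz (rderiveM _ df dg) (rderiveM _ df dg); exact: alg. Qed.

Lemma dzbarM (R : realType) (n : nat) (f g : Cspace R n -> Cplx R) x k :
  rdiff f x -> rdiff g x ->
  dzbar k (fun y => f y * g y) x = dzbar k f x * g x + f x * dzbar k g x.
Proof.
have alg (F : comNzRingType) (h i a b c d u w : F) : h * (a * w + u * b +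
    i * (c * w + u * d)) = h * (a + i * c) * w + u * (h * (b + i * d)) by ring.
move=> df dg; rewrite /dzbar (rderiveM _ df dg) (rderiveM _ df dg); exact: alg. Qed.

Lemma rderive_cst (R : realType) (n : nat) (c : Cplx R) (x v : Cspace R n) :
  rderive v (fun=> c) x = 0.
Proof. by have /is_rderiveP[_] := is_rderive_cst c x v. Qed.

Lemma dz_cst (R : realType) (n : nat) (c : Cplx R) (x : Cspace R n) k :
  dz k (fun=> c) x = 0.
Proof. by rewrite /dz !rderive_cst mulr0 subr0 mulr0. Qed.

Lemma dzbar_cst (R : realType) (n : nat) (c : Cplx R) (x : Cspace R n) k :
  dzbar k (fun=> c) x = 0.
Proof. by rewrite /dzbar !rderive_cst mulr0 addr0 mulr0. Qed.

(** The factor i in the Wirtinger operators changes sign under conjugation. *)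
Lemma dz_conj (R : realType) (n : nat) (f : Cspace R n -> Cplx R) x k :
  rdiff f x -> dz k (fun y => (f y)^*) x = (dzbar k f x)^*.
Proof.
have half : (2%:R^-1 : Cplx R)^* = 2%:R^-1 by rewrite fmorphV rmorph_nat.
have E (h i a b : Cplx R) : h^* = h -> i^* = - i ->
    (h * (a + i * b))^* = h * (a^* - i * b^*).
  move=> hJ iJ'; rewrite rmorphM rmorphD rmorphM.
  by rewrite [X in X * _]hJ [X in _ + X * _]iJ' mulNr.
by move=> df; rewrite /dz /dzbar !(rderive_conj _ df) (E _ _ _ _ half (conj_i R)).
Qed.

Lemma dzbar_conj (R : realType) (n : nat) (f : Cspace R n -> Cplx R) x k :
  rdiff f x -> dzbar k (fun y => (f y)^*) x = (dz k f x)^*.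
Proof.
move=> df; rewrite -[LHS]conjcK -dz_conj; last exact: rdiff_conj.
by under eq_fun do rewrite conjcK.
Qed.

(** Antiholomorphic factors are constants for d/dz_k. *)
Lemma dz_antiholM (R : realType) (n : nat) (c : Cplx R)
    (h u : Cspace R n -> Cplx R) x k :
  rdiff h x -> rdiff u x -> dzbar k h x = 0 ->
  dz k (fun y => c * (h y)^* * u y) x = c * (h x)^* * dz k u x.
Proof.
move=> dh du h0; have dhJ := rdiff_conj dh; have dc := rdiff_cst c x.
rewrite (dzM k (rdiffM dc dhJ) du) (dzM k dc dhJ) dz_cst (dz_conj k dh) h0.
by rewrite [X in c * X]conjc0 mulr0 mul0r addr0 mul0r add0r.
Qed.

(** The conjugate situation: holomorphic factors are constants for d/dzbar_k. *)
Lemma dzbar_holM (R : realType) (n : nat) (c : Cplx R)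
    (h u : Cspace R n -> Cplx R) x k :
  rdiff h x -> rdiff u x -> dzbar k h x = 0 ->
  dzbar k (fun y => c * h y * (u y)^*) x = c * h x * (dz k u x)^*.
Proof.
move=> dh du h0; have duJ := rdiff_conj du; have dc := rdiff_cst c x.
rewrite (dzbarM k (rdiffM dc dh) duJ) (dzbarM k dc dh) dzbar_cst h0.
by rewrite (dzbar_conj k du) mulr0 mul0r addr0 mul0r add0r.
Qed.

Lemma dz_lincomb (R : realType) (n m : nat)
    (f : 'I_m -> Cspace R n -> Cplx R) (c : 'I_m -> Cplx R) x k :
  (forall j, rdiff (f j) x) ->
  dz k (fun y => \sum_j f j y * c j) x = \sum_j dz k (f j) x * c j.
Proof.
move=> df; rewrite /dz !(rderive_lincomb _ _ df) mulr_sumr -sumrB mulr_sumr.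
by apply: eq_bigr => j _; rewrite mulrA -mulrBl mulrA.
Qed.

Lemma dzbar_lincomb (R : realType) (n m : nat)
    (f : 'I_m -> Cspace R n -> Cplx R) (c : 'I_m -> Cplx R) x k :
  (forall j, rdiff (f j) x) ->
  dzbar k (fun y => \sum_j f j y * c j) x = \sum_j dzbar k (f j) x * c j.
Proof.
move=> df; rewrite /dzbar !(rderive_lincomb _ _ df) mulr_sumr -big_split mulr_sumr.
by apply: eq_bigr => j _ /=; rewrite mulrA -mulrDl mulrA.
Qed.

Lemma near_dz (R : realType) (n : nat) (f g : Cspace R n -> Cplx R) x k :
  (\forall y \near x, f y = g y) -> dz k f x = dz k g x.
Proof. by move=> fg; rewrite /dz !(near_rderive _ fg). Qed.

Lemma near_dzbar (R : realType) (n : nat) (f g : Cspace R n -> Cplx R) x k :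
  (\forall y \near x, f y = g y) -> dzbar k f x = dzbar k g x.
Proof. by move=> fg; rewrite /dzbar !(near_rderive _ fg). Qed.

Lemma cderive_linear (R : realType) (n : nat) (f : Cspace R n -> Cplx R) x a v w :
  cderive (a *: v + w) f x = a * cderive v f x + cderive w f x.
Proof.
rewrite /cderive mulr_sumr -big_split; apply: eq_bigr => k _ /=.
have alg (F : comNzRingType) (c d e p q r s : F) :
  (c * p + q) * d + (c * r + s) * e = c * (p * d + r * e) + (q * d + s * e) by ring.
rewrite !mxE; exact: alg.
Qed.

Lemma cderive_conj_tangent (R : realType) (n : nat) (f : Cspace R n -> Cplx R) x v :
  rdiff f x -> cderive (conj_tangent v) f x = (cderive v (fun y => (f y)^*) x)^*.
Proof.
have E (a b c d : Cplx R) : a^* * c + b^* * d = (b * d^* + a * c^*)^*.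
  by rewrite rmorphD !rmorphM addrC; congr (_ * _ + _ * _); rewrite /= conjcK.
move=> df; rewrite /cderive rmorph_sum; apply: eq_bigr => k _.
by rewrite (dz_conj k df) (dzbar_conj k df) !mxE E.
Qed.

Lemma continuous_dz (R : realType) (n : nat) (U : set (Cspace R n))
    (f : Cspace R n -> Cplx R) x k :
  smooth_on U f -> U x -> {for x, continuous (dz k f)}.
Proof.
move=> /(_ 1%N)[_ Cf] Ux.
have c v : {for x, continuous (rderive v f)} by have [_ [cv _]] := Cf v; exact: cv.
have cc (a : Cplx R) : {for x, continuous (fun _ : Cspace R n => a)}.
  exact: cst_continuous.
have ci := continuousM (cc 'i%C) (c ('i%C *: delta_mx 0 k)).
exact: (continuousM (cc 2%:R^-1) (continuousB (c (delta_mx 0 k)) ci)).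
Qed.

Lemma smoothM (R : realType) (n : nat) (U : set (Cspace R n))
    (f g : Cspace R n -> Cplx R) :
  open U -> smooth_on U f -> smooth_on U g -> smooth_on U (fun x => f x * g x).
Proof. by move=> Uo sf sg r; apply: CrM. Qed.

Lemma holomorphicM (R : realType) (n : nat) (U : set (Cspace R n))
    (f g : Cspace R n -> Cplx R) :
  open U -> holomorphic_on U f -> holomorphic_on U g ->
  holomorphic_on U (fun x => f x * g x).
Proof.
move=> Uo [sf hf] [sg hg]; split; first exact: smoothM.
move=> x Ux k; rewrite dzbarM; [|exact: smooth_rdiff sf Ux|exact: smooth_rdiff sg Ux].
by rewrite hf // hg // mul0r mulr0 addr0.
Qed.

Lemma holomorphic_cst (R : realType) (n : nat) (U : set (Cspace R n)) (c : Cplx R) :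
  holomorphic_on U (fun=> c).
Proof. by split=> [r|x _ k]; [exact: Cr_cst|exact: dzbar_cst]. Qed.

(** * Charts and vector fields *)

Lemma chart_imageP (R : realType) (n : nat) (M : complexManifold R n)
    (i : chart_index M) x :
  chart_image i x -> chart_dom i (chartV i x) /\ chart i (chartV i x) = x.
Proof. by move=> [p pi <-]; rewrite chartK. Qed.

Lemma near_chart_image (R : realType) (n : nat) (M : complexManifold R n)
    (i : chart_index M) x : chart_image i x -> \forall y \near x, chart_image i y.
Proof.
by move=> Ux; apply: open_nbhs_nbhs; split=> //; exact: chart_open.
Qed.

Lemma change_chart_linear (R : realType) (n : nat) (M : complexManifold R n)
    (i j : chart_index M) (p : M) a v w :
  change_chart i j p (a *: v + w) =
  a *: change_chart i j p v + change_chart i j p w.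
Proof.
by congr (_, _); apply/rowP => l; rewrite !mxE cderive_linear.
Qed.

Lemma change_chart_scale (R : realType) (n : nat) (M : complexManifold R n)
    (i j : chart_index M) (p : M) a v :
  change_chart i j p (a *: v) = a *: change_chart i j p v.
Proof.
have c0 : change_chart i j p 0 = 0.
  have := change_chart_linear i j p (-1) 0 0.
  by rewrite scaler0 addr0 scaleN1r addNr.
by rewrite -[X in change_chart i j p X]addr0 change_chart_linear c0 addr0.
Qed.

(** The differential of a transition map is real; this makes [twice_Re Z]
    compatible with the change of charts. *)
Lemma change_chart_conj (R : realType) (n : nat) (M : complexManifold R n)
    (i j : chart_index M) (p : M) v :
  chart_dom i p -> chart_dom j p ->
  change_chart i j p (conj_tangent v) = conj_tangent (change_chart i j p v).
Proof.
move=> pi pj.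
have df l : rdiff (fun x => transition i j x 0 l) (chart i p).
  have [sm _] := transition_holomorphic i j l.
  by apply: smooth_rdiff sm _; exists p.
congr (_, _); apply/rowP => l; rewrite !mxE.
  by rewrite cderive_conj_tangent.
rewrite cderive_conj_tangent; last exact: rdiff_conj.
by under eq_fun do rewrite conjcK.
Qed.

Lemma conj_tangentK (R : realType) (n : nat) : involutive (@conj_tangent R n).
Proof.
have K (a : Cspace R n) : map_mx conjc (map_mx conjc a) = a.
  by apply/rowP => l; rewrite !mxE conjcK.
by move=> [a b]; rewrite /conj_tangent /= !K.
Qed.

Lemma conj_tangentD (R : realType) (n : nat) (v w : Ctangent R n) :
  conj_tangent (v + w) = conj_tangent v + conj_tangent w.
Proof.
by congr (_, _); apply/rowP => l; rewrite !mxE rmorphD.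
Qed.

Lemma twice_Re_real_field (R : realType) (n : nat) (M : complexManifold R n)
    (Z : cvfield M) : holomorphic_field Z -> real_field (twice_Re Z).
Proof.
move=> [cZ Z0 hZ]; split.
- move=> p i j pi pj; rewrite /twice_Re /conj_field (cZ p i j pi pj).
  rewrite -change_chart_conj // -[X in X + _]scale1r -change_chart_linear.
  by rewrite scale1r.
- by move=> p i pi; rewrite /twice_Re conj_tangentD conj_tangentK addrC.
- move=> i l; have Uo : open (chart_image i) by exact: chart_open.
  have [sZ _] := hZ i l.
  split=> r.
    apply: (eq_Cr Uo) (sZ r) => x Ux; have [xi _] := chart_imageP Ux.
    by rewrite /= (Z0 _ _ xi) !mxE [X in _ + X]conjc0 addr0.
  apply: (eq_Cr Uo) (Cr_conj Uo (sZ r)) => x Ux; have [xi _] := chart_imageP Ux.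
  by rewrite /= (Z0 _ _ xi) !mxE add0r.
Qed.

Definition scale_field (R : realType) (n : nat) (M : complexManifold R n)
    (a : Cplx R) (Z : cvfield M) : cvfield M := fun p i => a *: Z p i.

Lemma holomorphic_scale_field (R : realType) (n : nat) (M : complexManifold R n)
    (a : Cplx R) (Z : cvfield M) :
  holomorphic_field Z -> holomorphic_field (scale_field a Z).
Proof.
move=> [cZ Z0 hZ]; split.
- move=> p i j pi pj; rewrite /scale_field (cZ p i j pi pj).
  by rewrite change_chart_scale.
- by move=> p i pi; rewrite /scale_field /= Z0 // scaler0.
- move=> i l; rewrite /scale_field /=.
  under eq_fun do rewrite mxE.
  by apply: holomorphicM; [exact: chart_open|exact: holomorphic_cst|exact: hZ].
Qed.

(** - i (Z - conj Z) = (- i Z) + conj (- i Z).  It reduces every statement on the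
    second real field to the first one. *)
Lemma twice_Im_scale (R : realType) (n : nat) (M : complexManifold R n)
    (Z : cvfield M) : twice_Im Z = twice_Re (scale_field (- 'i%C) Z).
Proof.
apply: funext => p; apply: funext => i.
rewrite /twice_Im /twice_Re /scale_field scalerBr; congr (_ + _).
rewrite scaleNr opprK /conj_field.
by congr (_, _); apply/rowP => l; rewrite !mxE rmorphM [X in _ = X * _]conjNi.
Qed.

(** * Densities and divergence *)

Definition vol_density (R : realType) (n : nat) (M : complexManifold R n)
    (omega : cform M n) (i : chart_index M) (x : Cspace R n) : Cplx R :=
  omega (chartV i x) i (fun s => (delta_mx 0 s, 0)).

(** The holomorphic function h with alpha omega = h dz_1 ... dz_n in chart i. *)
Definition mult_density (R : realType) (n : nat) (M : complexManifold R n)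
    (omega : cform M n) (alpha : M -> Cplx R) (i : chart_index M)
    (x : Cspace R n) : Cplx R :=
  alpha (chartV i x) * vol_density omega i x.

Definition divergence (R : realType) (n : nat) (M : complexManifold R n)
    (omega : cform M n) (Z : cvfield M) (alpha : M -> Cplx R)
    (i : chart_index M) (x : Cspace R n) : Cplx R :=
  \sum_k dz k (fun y => mult_density omega alpha i y * (Z (chartV i y) i).1 0 k) x.

Lemma holomorphic_formE (R : realType) (n : nat) (M : complexManifold R n)
    (omega : cform M n) p i v :
  holomorphic_form omega -> chart_dom i p ->
  omega p i v = vol_density omega i (chart i p) * \det (\matrix_s (v s).1).
Proof.
move=> [alt _ van _] pi; rewrite /vol_density chartK //.
by apply: form_det; [exact: alt|move=> w s; exact: van].
Qed.

Lemma mult_density_holomorphic (R : realType) (n : nat) (M : complexManifold R n)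
    (omega : cform M n) (alpha : M -> Cplx R) i :
  holomorphic_form omega -> holomorphic_function alpha ->
  holomorphic_on (chart_image i) (mult_density omega alpha i).
Proof.
by move=> [_ _ _ hom] ha; apply: holomorphicM; [exact: chart_open|exact: ha|exact: hom].
Qed.

Lemma del_multE (R : realType) (n : nat) (M : complexManifold R n.+1)
    (omega : cform M n.+1) (Z : cvfield M) (alpha : M -> Cplx R) p i v :
  holomorphic_form omega -> holomorphic_field Z -> holomorphic_function alpha ->
  chart_dom i p ->
  del (mul_form alpha (Defs.interior Z omega)) p i v =
  divergence omega Z alpha i (chart i p) * \det (\matrix_s (v s).1).
Proof.
move=> hom [_ _ hZ] ha pi; set V := \matrix_s _.
have Up : chart_image i (chart i p) by exists p.
rewrite /divergence -(divergence_det (D := fun k f => dz k f (chart i p))); last first.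
  move=> k c; apply: dz_lincomb => j; apply: rdiffM.
    exact: smooth_rdiff (mult_density_holomorphic i hom ha).1 Up.
  exact: smooth_rdiff (hZ i j).1 Up.
apply: eq_bigr => s _; congr (_ * _); rewrite /cderive.
apply: eq_bigr => k _; rewrite /= [X in _ + X * _]mxE mul0r addr0 mxE.
congr (_ * _); apply: near_dz; apply: filterS (near_chart_image Up) => y Uy.
have [yi yE] := chart_imageP Uy.
rewrite /mul_form /Defs.interior (holomorphic_formE _ hom yi) yE mulrA.
congr (_ * \det _); apply/matrixP => a b; rewrite !mxE.
by case: unliftP => [t|] _ //=; rewrite !mxE.
Qed.

(** * The real volume form and its contractions *)

Definition tangent_matrix (R : realType) (n : nat)
    (v : 'I_(n + n) -> Ctangent R n) : 'M[Cplx R]_(n + n) :=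
  \matrix_s row_mx (v s).1 (v s).2.

(** By [form_det] the wedge product is a sum over permutations of products of two
    n x n minors of [tangent_matrix v]; [laplace_block] evaluates it. *)
Lemma wedge_conjE (R : realType) (n : nat) :
  exists2 c : Cplx R, c != 0 &
  forall (M : complexManifold R n) (omega : cform M n) p i v,
    holomorphic_form omega -> chart_dom i p ->
    wedge omega (conj_form omega) p i v =
    c * (vol_density omega i (chart i p) * (vol_density omega i (chart i p))^*)
      * \det (tangent_matrix v).
Proof.
have [c c0 lap] := laplace_block (Cplx R) n n.
exists ((n`! * n`!)%N%:R^-1 * c%:R).
  rewrite mulf_neq0 ?invr_eq0 ?pnatr_eq0 //.
  by rewrite muln_eq0 negb_or -!lt0n fact_gt0.
move=> M omega p i v hom pi; rewrite /wedge /conj_form.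
set f := vol_density _ _ _.
transitivity ((n`! * n`!)%N%:R^-1 * ((f * f^*) * (c%:R * \det (tangent_matrix v)))).
  congr (_ * _); rewrite -lap mulr_sumr; apply: eq_bigr => sigma _.
  rewrite !(holomorphic_formE _ hom pi) -/f conjM.
  set A := \det _; set B := \det _; set A' := \det _; set B' := \det _.
  have -> : A = A'.
    by congr (\det _); apply/matrixP => a b; rewrite mxE [RHS]mxE [RHS]mxE row_mxEl.
  have BB' : B^* = B'.
    rewrite -[LHS]/(conjc (\det _)) -det_map_mx.
    congr (\det _); apply/matrixP => a b; rewrite [RHS]mxE [RHS]mxE row_mxEr.
    by rewrite !mxE; exact: conjcK.
  have alg (F : comNzRingType) (s a b b' u w : F) :
    b = b' -> s * (u * a) * (w * b) = u * w * (s * a * b') by move=> ->; ring.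
  exact: (alg _ _ _ _ _ _ _ BB').
have alg (F : comNzRingType) (h a u d : F) : h * (u * (a * d)) = h * a * u * d by ring.
exact: alg.
Qed.

Lemma sqr_modulusE (R : realType) (T : Type) (alpha : T -> Cplx R) p :
  (sqr_modulus alpha p)%:C = alpha p * (alpha p)^*.
Proof.
rewrite /sqr_modulus; case: (alpha p) => a b /=.
rewrite sqr_sqrtr ?addr_ge0 ?sqr_ge0 //.
by apply/eqP; rewrite eq_complex /=; apply/andP; split; apply/eqP; ring.
Qed.

(** The 2n operators d/dz_k and d/dzbar_k as a single family, to which
    [divergence_det] applies in dimension 2n. *)
Definition dz_dzbar (R : realType) (n : nat) (x : Cspace R n) (k : 'I_(n + n))
    (f : Cspace R n -> Cplx R) : Cplx R :=
  match fintype.split k with inl a => dz a f x | inr b => dzbar b f x end.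

Lemma dz_dzbar_lincomb (R : realType) (n m : nat) (x : Cspace R n) (k : 'I_(n + n))
    (f : 'I_m -> Cspace R n -> Cplx R) (c : 'I_m -> Cplx R) :
  (forall j, rdiff (f j) x) ->
  dz_dzbar x k (fun y => \sum_j f j y * c j) = \sum_j dz_dzbar x k (f j) * c j.
Proof.
rewrite /dz_dzbar; case: fintype.split => a df; [exact: dz_lincomb|exact: dzbar_lincomb].
Qed.

Lemma near_dz_dzbar (R : realType) (n : nat) (x : Cspace R n) (k : 'I_(n + n))
    (f g : Cspace R n -> Cplx R) :
  (\forall y \near x, f y = g y) -> dz_dzbar x k f = dz_dzbar x k g.
Proof.
by rewrite /dz_dzbar; case: fintype.split => a fg; [exact: near_dz|exact: near_dzbar].
Qed.

Lemma cderive_dz_dzbar (R : realType) (n : nat) (x : Cspace R n) (v : Ctangent R n)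
    (f : Cspace R n -> Cplx R) :
  cderive v f x = \sum_k row_mx v.1 v.2 0 k * dz_dzbar x k f.
Proof.
rewrite big_split_ord /= -big_split; apply: eq_bigr => k _ /=.
by rewrite row_mxEl row_mxEr /dz_dzbar !(unsplitK (inl _), unsplitK (inr _)).
Qed.

(** The form is a density g = c h conj h times the contraction of the 2N-dimensional
    determinant, so its derivative is the divergence of g (Z, conj Z).
    In the terms d/dz_k (c h conj h Z_k) the factor c conj h comes out
    ([dz_antiholM]); the terms d/dzbar_k are treated by [dzbar_holM]. *)
Lemma extd_real_multE (R : realType) (n : nat) :
  exists2 c : Cplx R, c != 0 &
  forall (M : complexManifold R n.+1) (omega : cform M n.+1) (Z : cvfield M)
    (alpha : M -> Cplx R) p i v,
  holomorphic_form omega -> holomorphic_field Z -> holomorphic_function alpha ->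
  chart_dom i p ->
  let x := chart i p in
  extd (mul_form (fun q => (sqr_modulus alpha q)%:C)
    (Defs.interior (twice_Re Z) (real_volume_form omega))) p i v =
  c * ((mult_density omega alpha i x)^* * divergence omega Z alpha i x
       + mult_density omega alpha i x * (divergence omega Z alpha i x)^*)
    * \det (tangent_matrix (v : 'I_(n.+1 + n.+1) -> Ctangent R n.+1)).
Proof.
have algl (F : comNzRingType) (e u w a : F) : e * (u * w) * a = e * w * (u * a)
  by ring.
have algr (F : comNzRingType) (e u w a b : F) :
  b = w * a -> e * (u * w) * a = e * u * b by move=> ->; ring.
have algm (F : comNzRingType) (a b e u w d q : F) :
  q = b * w -> a * b * (e * (u * w) * d) = e * (a * u * q) * d by move=> ->; ring.
have [c c0 wE] := wedge_conjE R n.+1; exists c => //.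
move=> M omega Z alpha p i v hom [_ Z0 hZ] ha pi /=.
set x := chart i p; set V := tangent_matrix _.
have Ux : chart_image i x by exists p.
set h := mult_density omega alpha i.
have hh : holomorphic_on (chart_image i) h := mult_density_holomorphic i hom ha.
have dh : rdiff h x := smooth_rdiff hh.1 Ux.
pose z k y := (Z (chartV i y) i).1 0 k.
have dzk k : rdiff (z k) x := smooth_rdiff (hZ i k).1 Ux.
pose g y := c * (h y * (h y)^*).
have dg : rdiff g x.
  exact: (rdiffM (rdiff_cst c x) (rdiffM dh (rdiff_conj dh))).
have dhz k : rdiff (fun y => h y * z k y) x := rdiffM dh (dzk k).
pose Y y : 'rV[Cplx R]_(n.+1 + n.+1) :=
  row_mx (\row_k z k y) (\row_k (z k y)^*).
have dY j : rdiff (fun y => g y * Y y 0 j) x.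
  rewrite /Y -(splitK j); case: fintype.split => a /=.
    under eq_fun do rewrite row_mxEl mxE.
    exact: (rdiffM dg (dzk a)).
  under eq_fun do rewrite row_mxEr mxE.
  exact: (rdiffM dg (rdiff_conj (dzk a))).
transitivity ((\sum_j dz_dzbar x j (fun y => g y * Y y 0 j)) * \det V); last first.
  have divJ : (divergence omega Z alpha i x)^* =
      \sum_k (dz k (fun y => h y * z k y) x)^* by exact: conj_sum.
  congr (_ * _); rewrite big_split_ord mulrDr; congr (_ + _).
    rewrite /divergence mulrA mulr_sumr; apply: eq_bigr => k _.
    have -> : (fun y => g y * Y y 0 (lshift n.+1 k)) =
        (fun y => c * (h y)^* * (h y * z k y)).
      by apply: funext => y; rewrite /g row_mxEl mxE; exact: algl.
    rewrite /dz_dzbar (unsplitK (inl _)).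
    exact: (dz_antiholM c dh (dhz k) (hh.2 x Ux k)).
  apply: (@eq_trans _ _ (c * h x * \sum_k (dz k (fun y => h y * z k y) x)^*));
    last by rewrite -mulrA; congr (_ * (_ * _)); exact/esym.
  rewrite mulr_sumr; apply: eq_bigr => k _.
  have -> : (fun y => g y * Y y 0 (rshift n.+1 k)) =
      (fun y => c * h y * (h y * z k y)^*).
    by apply: funext => y; rewrite /g row_mxEr mxE; exact: algr (conjM _ _).
  rewrite /dz_dzbar (unsplitK (inr _)).
  exact: (dzbar_holM c dh (dhz k) (hh.2 x Ux k)).
rewrite -(@divergence_det _ (n + n.+1) _ (@dz_dzbar R n.+1 x)); last first.
  by move=> k d; apply: dz_dzbar_lincomb.
apply: eq_bigr => s _; congr (_ * _); rewrite cderive_dz_dzbar.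
apply: eq_bigr => k _; congr (_ * _); first by rewrite [RHS]mxE.
apply: near_dz_dzbar; apply: filterS (near_chart_image Ux) => y Uy.
have [yi yE] := chart_imageP Uy.
rewrite /mul_form /Defs.interior sqr_modulusE /real_volume_form (wE _ _ _ _ _ hom yi) yE.
set D1 := \det _; set D2 := \det _; have -> : D1 = D2.
  congr (\det _); apply/matrixP => a b; rewrite mxE [RHS]mxE.
  case: unliftP => [t|] _ /=; first by rewrite [RHS]mxE [RHS]mxE.
  rewrite /Y /z /twice_Re /conj_field /conj_tangent /= (Z0 _ _ yi).
  congr (row_mx _ _ _ b); apply/rowP => l; rewrite !mxE ?add0r //.
  by rewrite [X in _ + X]conjc0 addr0.
rewrite /g /h /mult_density; exact: algm (conjM _ _).
Qed.

(** * The two multiplier conditions as equations on the divergence *)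

Lemma divergence_scale (R : realType) (n : nat) (M : complexManifold R n)
    (omega : cform M n) (Z : cvfield M) (alpha : M -> Cplx R) (a : Cplx R) i x :
  holomorphic_form omega -> holomorphic_field Z -> holomorphic_function alpha ->
  chart_image i x ->
  divergence omega (scale_field a Z) alpha i x = a * divergence omega Z alpha i x.
Proof.
move=> hom [_ _ hZ] ha Ux; rewrite /divergence mulr_sumr.
apply: eq_bigr => k _.
have -> : (fun y => mult_density omega alpha i y
                    * (scale_field a Z (chartV i y) i).1 0 k) =
    (fun y => a * (mult_density omega alpha i y * (Z (chartV i y) i).1 0 k)).
  by apply: funext => y; rewrite mxE mulrCA.
rewrite dzM; [|exact: rdiff_cst|].
  by rewrite dz_cst mul0r add0r.
apply: rdiffM; first exact: smooth_rdiff (mult_density_holomorphic i hom ha).1 Ux.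
exact: smooth_rdiff (hZ i k).1 Ux.
Qed.

Lemma continuous_divergence (R : realType) (n : nat) (M : complexManifold R n)
    (omega : cform M n) (Z : cvfield M) (alpha : M -> Cplx R) i x :
  holomorphic_form omega -> holomorphic_field Z -> holomorphic_function alpha ->
  chart_image i x -> {for x, continuous (divergence omega Z alpha i)}.
Proof.
move=> hom [_ _ hZ] ha Ux.
have c k : {for x, continuous (dz k (fun y =>
    mult_density omega alpha i y * (Z (chartV i y) i).1 0 k))}.
  apply: continuous_dz _ Ux; apply: smoothM; first exact: chart_open.
    exact: (mult_density_holomorphic i hom ha).1.
  exact: (hZ i k).1.
rewrite /continuous_at /divergence; have Fx := @nbhs_filter (Cspace R n) x.
by apply: cvg_big => [|k _]; [exact: add_continuous|exact: c].
Qed.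

(** Where the divergence D is nonzero it stays nonzero nearby, by continuity;
    there the function h of [mult_density] is zero, so D, a sum of derivatives of
    h Z_k, is zero after all. *)
Lemma divergence_eq0 (R : realType) (n : nat) (M : complexManifold R n)
    (omega : cform M n) (Z : cvfield M) (alpha : M -> Cplx R) i :
  holomorphic_form omega -> holomorphic_field Z -> holomorphic_function alpha ->
  (forall x, chart_image i x -> mult_density omega alpha i x = 0 \/
     divergence omega Z alpha i x = 0) ->
  forall x, chart_image i x -> divergence omega Z alpha i x = 0.
Proof.
move=> hom hZ ha hD x Ux; apply/eqP/negPn/negP => Dx.
have cD := continuous_divergence hom hZ ha Ux.
have nD : \forall y \near x, divergence omega Z alpha i y != 0.
  have Fx := @nbhs_filter (Cspace R n) x.
  exact: (@cvgr_neq0 _ (Cplx R) _ _ Fx _ _ cD Dx).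
have nh : \forall y \near x, mult_density omega alpha i y = 0.
  have nU := near_chart_image Ux; near=> y.
  have [//|D0] : mult_density omega alpha i y = 0 \/ divergence omega Z alpha i y = 0.
    by apply: hD; near: y.
  have : divergence omega Z alpha i y != 0 by near: y.
  by rewrite D0 eqxx.
move: Dx; rewrite /divergence big1 ?eqxx // => k _.
rewrite (@near_dz _ _ _ (fun=> 0)) ?dz_cst //.
by apply: filterS nh => y ->; rewrite mul0r.
Unshelve. all: by end_near. Qed.

(** On the vectors d/dz_s the determinant in [del_multE] is 1. *)
Lemma holomorphic_last_multiplierP (R : realType) (n : nat)
    (M : complexManifold R n.+1) (omega : cform M n.+1) (Z : cvfield M)
    (alpha : M -> Cplx R) :
  holomorphic_form omega -> holomorphic_field Z -> holomorphic_function alpha ->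
  holomorphic_last_multiplier omega Z alpha <->
  forall i x, chart_image i x -> divergence omega Z alpha i x = 0.
Proof.
move=> hom hZ ha; split=> [[_ _ z] i x [p pi <-]|D0].
  have := z p i (fun s => (delta_mx 0 s, 0)) pi.
  rewrite del_multE //; set A := \matrix_s _; have -> : A = 1%:M.
    by apply/matrixP => a b; rewrite !mxE /= eq_sym.
  by rewrite det1 mulr1.
split=> // p i v pi; rewrite del_multE // D0 ?mul0r //.
by exists p.
Qed.

(** The equation is twice the real part of conj h D; the converse direction
    evaluates [extd_real_multE] on the coordinate vectors, whose matrix is 1. *)
Lemma real_last_multiplierP (R : realType) (n : nat)
    (M : complexManifold R n.+1) (omega : cform M n.+1) (Z : cvfield M)
    (alpha : M -> Cplx R) :
  holomorphic_form omega -> holomorphic_field Z -> holomorphic_function alpha ->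
  real_last_multiplier (real_volume_form omega) (twice_Re Z) (sqr_modulus alpha) <->
  forall i x, chart_image i x ->
    (mult_density omega alpha i x)^* * divergence omega Z alpha i x
    + mult_density omega alpha i x * (divergence omega Z alpha i x)^* = 0.
Proof.
move=> hom hZ ha; have [c c0 extE] := extd_real_multE R n.
split=> [[_ _ z] i x [p pi <-]|D0].
  pose v (s : 'I_(n.+1 + n.+1)) : Ctangent R n.+1 :=
    (lsubmx (row s 1%:M), rsubmx (row s 1%:M)).
  have := z p i v pi; rewrite extE //.
  have -> : tangent_matrix v = 1%:M.
    by apply/row_matrixP => s; rewrite rowK hsubmxK.
  by rewrite det1 mulr1 => /eqP; rewrite mulf_eq0 (negPf c0) => /eqP.
split; last by move=> p i v pi; rewrite extE // D0 ?mulr0 ?mul0r //; exists p.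
  move=> i r; have [sa _] := ha i.
  have Uo : open (chart_image i) by exact: chart_open.
  under eq_fun do rewrite sqr_modulusE.
  by apply: CrM => //; apply: Cr_conj.
exact: twice_Re_real_field.
Qed.

Theorem theorem2p1 (R : realType) (n : nat) (M : complexManifold R n.+1)
    (omega : cform M n.+1) (Z : cvfield M) (alpha : M -> R[i])
    (omega_vol : holomorphic_volume_form omega)
    (Z_hol : holomorphic_field Z)
    (alpha_hol : holomorphic_function alpha) :
  holomorphic_last_multiplier omega Z alpha <->
  real_last_multiplier (real_volume_form omega) (twice_Re Z)
    (sqr_modulus alpha) /\
  real_last_multiplier (real_volume_form omega) (twice_Im Z)
    (sqr_modulus alpha).
Proof.
have [hom _] := omega_vol.
have hZi := holomorphic_scale_field (- 'i%C) Z_hol.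
rewrite twice_Im_scale; split.
  move=> /(holomorphic_last_multiplierP hom Z_hol alpha_hol) D0.
  split; apply/(real_last_multiplierP hom _ alpha_hol) => // i x Ux.
    by rewrite D0 // mulr0 add0r [X in _ * X]conjc0 mulr0.
  rewrite divergence_scale // D0 // mulr0 mulr0 add0r [X in _ * X]conjc0.
  by rewrite mulr0.
move=> [/(real_last_multiplierP hom Z_hol alpha_hol) DRe
        /(real_last_multiplierP hom hZi alpha_hol) DIm].
apply/(holomorphic_last_multiplierP hom Z_hol alpha_hol) => i.
apply: divergence_eq0 => // x Ux.
have := DIm i x Ux; have := DRe i x Ux; rewrite divergence_scale //.
set h := mult_density _ _ _ _; set D := divergence _ _ _ _ _.
(* With w = conj a * b, the equations are w + conj w = 0 and
   - j (w - conj w) = 0; together they give 2 j w = 0. *)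
have alg (F : comNzRingType) (j a a' b b' q q' : F) : q = - j -> q' = j * b' ->
    a' * b + a * b' = 0 -> a' * (q * b) + a * q' = 0 -> j * (a' * b) *+ 2 = 0.
  move=> -> -> e1 e2.
  have -> : j * (a' * b) *+ 2
    = j * (a' * b + a * b') - (a' * (- j * b) + a * (j * b')) by ring.
  by rewrite e1 e2 mulr0 subr0.
have qJ : (- 'i%C * D : Cplx R)^* = 'i%C * D^*.
  by rewrite -[in RHS](conjNi R); exact: conjM.
move=> e1 e2; have /eqP := alg _ _ _ _ _ _ _ _ (erefl _) qJ e1 e2.
have i0 : ('i%C : Cplx R) != 0 by rewrite eq_complex /= oner_eq0 andbF.
rewrite mulrn_eq0 /= mulf_eq0 [X in X || _](negPf i0) mulf_eq0 /=.
by case/orP => /eqP e; [left; rewrite -[LHS]conjcK [X in conjc X]e conjc0|right].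
Qed.
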